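(* Let $\mathcal{I}$ be a translation invariant ideal on $\mathbb{N}$ with the Baire property. Then there is a translation invariant and rich abstract upper density $\delta$ such that $\mathcal{Z}_\delta=\mathcal{I}$.
   Context: For $A\subseteq\mathbb{N}$ and $k\in\mathbb{Z}$, $A+k$ denotes $\{a+k:a\in A\}\cap\mathbb{N}$. An abstract upper density on $\mathbb{N}$ is a function $\delta:\mathcal{P}(\mathbb{N})\to[0,1]$ such that $\delta(\mathbb{N})=1$; $\delta(F)=0$ for every finite $F\subseteq\mathbb{N}$; $A\subseteq B$ implies $\delta(A)\le\delta(B)$; and $\delta(A\cup B)\le\delta(A)+\delta(B)$. It is translation invariant if $\delta(A+k)=\delta(A)$ for all $A\subseteq\mathbb{N}$, $k\in\mathbb{Z}$, and rich if for every $r\in[0,1]$ there is $A\subseteq\mathbb{N}$ with $\delta(A)=r$. $\mathcal{Z}_\delta=\{A\subseteq\mathbb{N}:\delta(A)=0\}$. An ideal on $\mathbb{N}$ is a family $\mathcal{I}\subseteq\mathcal{P}(\mathbb{N})$ closed under finite unions and subsets, containing all finite subsets of $\mathbb{N}$, with $\mathbb{N}\notin\mathcal{I}$; it is translation invariant if $A+k\in\mathcal{I}$ for all $A\in\mathcal{I}$, $k\in\mathbb{Z}$. Subsets of $\mathbb{N}$ are identified with their characteristic functions, so $\mathcal{P}(\mathbb{N})$ carries the topology of the Cantor space $\{0,1\}^{\mathbb{N}}$; an ideal has the Baire property if it has the Baire property as a subset of this space. *)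

(* Defs.v *)
From mathcomp Require Import all_boot all_order all_algebra.
From mathcomp Require Import all_classical all_reals topology cantor.

Set Implicit Arguments.
Unset Strict Implicit.
Unset Printing Implicit Defensive.

Import Order.TTheory GRing.Theory Num.Theory.

Local Open Scope classical_set_scope.
Local Open Scope ring_scope.

(* The equation is in [int], so negative values of [a + k] are discarded,
   which is the intersection with N. *)
Definition shift (A : set nat) (k : int) : set nat :=
  [set n : nat | exists2 a : nat, A a & n%:Z = a%:Z + k].

Record is_upper_density (R : realType) (delta : set nat -> R) : Prop :=
  IsUpperDensity {
    upper_density_itv : forall A, 0 <= delta A <= 1;
    upper_densityT : delta [set: nat] = 1;
    upper_density_finite : forall F, finite_set F -> delta F = 0;
    upper_density_mono : forall A B, A `<=` B -> delta A <= delta B;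
    upper_density_subadd : forall A B,
      delta (A `|` B) <= delta A + delta B
  }.

Definition density_shift_invariant (R : realType) (delta : set nat -> R) :
    Prop :=
  forall (A : set nat) (k : int), delta (shift A k) = delta A.

Definition rich (R : realType) (delta : set nat -> R) : Prop :=
  forall r : R, 0 <= r <= 1 -> exists A : set nat, delta A = r.

Definition null_sets (R : realType) (delta : set nat -> R) : set (set nat) :=
  [set A | delta A = 0].

Record is_ideal (I : set (set nat)) : Prop := IsIdeal {
  idealU : forall A B, I A -> I B -> I (A `|` B);
  ideal_sub : forall A B, A `<=` B -> I B -> I A;
  ideal_finite : forall F, finite_set F -> I F;
  ideal_proper : ~ I [set: nat]
}.

Definition ideal_shift_invariant (I : set (set nat)) : Prop :=
  forall (A : set nat) (k : int), I A -> I (shift A k).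

Definition nowhere_dense (T : topologicalType) (A : set T) : Prop :=
  (closure A)° = set0.

Definition meager (T : topologicalType) (A : set T) : Prop :=
  exists2 F : nat -> set T,
    (forall n, nowhere_dense (F n)) & A = \bigcup_n F n.

Definition baire_property (T : topologicalType) (A : set T) : Prop :=
  exists2 U : set T, open U & meager (A `+` U).

Definition char_fun (A : set nat) : cantor_space := fun n => n \in A.

Definition ideal_baire_property (I : set (set nat)) : Prop :=
  baire_property (char_fun @` I).

(* Main.v *)
(**
  By an argument of Talagrand and Jalali-Naini, an ideal with the Baire property
  admits a partition of N into consecutive finite intervals such that no member
  of the ideal contains infinitely many of them.  Let [f] be constant on each
  interval and oscillate between 0 and 1 so that its increments tend to 0 while
  every value is approached infinitely often.  Call [A] bounded if
  [A `\` [set n | s <= f n]] is in [I] for some [s > 0].  The density of [A] is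
  the limsup of [f] along [A] modulo [I] when [A] is bounded, and 1 otherwise.
  Slow variation of [f] gives translation invariance, recurrence of its values
  gives richness, and the value 1 on unbounded sets is what keeps sets along
  which [f] tends to 0 from becoming null.
*)
Require Import Defs.
From mathcomp Require Import all_boot all_order all_algebra.
From mathcomp Require Import all_classical all_reals topology cantor.
From mathcomp Require Import zify ring lra.

Set Implicit Arguments.
Unset Strict Implicit.
Unset Printing Implicit Defensive.

Import Order.TTheory GRing.Theory Num.Theory.

Local Open Scope classical_set_scope.
Local Open Scope ring_scope.

(** * Cylinders of the Cantor space and the blocks of Talagrand and Jalali-Naini *)

Definition cylinder (x : cantor_space) (n : nat) : set cantor_space :=
  [set y | forall i, (i < n)%N -> y i = x i].

Lemma cylinder_nbhs (x : cantor_space) (n : nat) : nbhs x (cylinder x n).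
Proof.
elim: n => [|n IHn]; first by apply: filterS filterT => y _ i; rewrite ltn0.
have projn : nbhs x [set y : cantor_space | y n = x n].
  have : nbhs (x n) [set x n] by exact: discrete_set1.
  exact: (@proj_continuous nat (fun=> bool) n x).
apply: filterS2 projn IHn => y /= ynE yn i.
by rewrite ltnS leq_eqVlt => /predU1P[->//|/yn].
Qed.

Lemma nbhs_cylinder (x : cantor_space) (U : set cantor_space) :
  nbhs x U -> exists n, cylinder x n `<=` U.
Proof.
pose G := filter_from [set: nat] (cylinder x).
have GF : Filter G.
  apply: filter_from_filter; first by exists 0%N.
  move=> i j _ _; exists (maxn i j) => // y yij; split=> k kl; apply: yij; lia.
have Gx : G --> x.
  (* The product topology is a supremum over coordinates, so convergence is checked one coordinate
     at a time. *)
  apply/cvg_sup => i A; rewrite nbhsE => -[_ [[V oV <-] /= Vx] VA].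
  by exists i.+1 => // y yx; apply: VA => /=; rewrite yx.
by move=> /Gx[n _ nU]; exists n.
Qed.

Lemma nowhere_dense_cylinder (F : set cantor_space) (x : cantor_space) n :
  nowhere_dense F ->
  exists y m, [/\ (n <= m)%N, cylinder x n y & cylinder y m `&` F = set0].
Proof.
move=> ndF.
have [y xy nFy] : exists2 y, cylinder x n y & ~ closure F y.
  apply: contrapT => noy; suff : (closure F)° x by rewrite ndF.
  apply: filterS (cylinder_nbhs x n) => y xy.
  by apply: contrapT => nFy; apply: noy; exists y.
have [|m mF] := @nbhs_cylinder y (~` closure F).
  apply: open_nbhs_nbhs; split=> //.
  by apply: closed_openC; exact: closed_closure.
exists y, (maxn n m); split=> //; first by rewrite leq_maxl.
rewrite -subset0 => z [yz Fz]; apply: (mF z); last exact: subset_closure.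
by move=> i im; apply: yz; lia.
Qed.

(** The pattern must work for all bits below [n], since later on agreement is known on this block
    only. *)
Lemma block_avoiding (F : nat -> set cantor_space) (k n : nat) :
  (forall j, nowhere_dense (F j)) ->
  exists m (s : cantor_space), (n < m)%N /\ forall x : cantor_space,
    (forall i, (n <= i < m)%N -> x i = s i) ->
    forall j, (j <= k)%N -> ~ F j x.
Proof.
move=> ndF.
(* The conditions indexed by a prefix of length n and some j <= k are met one
   after the other, each time extending the pattern. *)
pose tasks := enum {: n.-tuple bool * 'I_k.+1}.
suff [m [s [nm avoid]]] : exists m (s : cantor_space), (n < m)%N /\
    forall uj, uj \in tasks -> forall x : cantor_space,
      (forall i, (i < n)%N -> x i = nth false uj.1 i) ->
      (forall i, (n <= i < m)%N -> x i = s i) -> ~ F uj.2 x.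
  exists m, s; split=> // x xs j jk.
  apply: (avoid ([tuple x i | i < n], Ordinal (jk : j < k.+1)%N)) => //=.
    by rewrite mem_enum.
  move=> i iln; rewrite -[i]/(val (Ordinal iln)).
  by rewrite -[RHS](tnth_nth _ [tuple x i | i < n]) tnth_mktuple.
elim: tasks => [|[u j] L [m [s [nm avoid]]]].
  by exists n.+1, (fun=> false).
(* [p] glues the prefix [u] to the pattern found so far; agreeing with [p] below [m] preserves the
   earlier conditions. *)
pose p : cantor_space := fun i => if (i < n)%N then nth false u i else s i.
have [y [m' [mm' py yF]]] := nowhere_dense_cylinder p m (ndF j).
exists m', y; split; first exact: leq_trans mm'.
move=> uj; rewrite in_cons => /predU1P[->{uj}/=|ujL] x xu xs.
  move=> Fx; suff : (cylinder y m' `&` F j) x by rewrite yF.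
  split=> // i im'; have [iln|nlei] := ltnP i n.
    by rewrite xu// py ?/p ?iln//; lia.
  by rewrite xs// nlei.
apply: (avoid _ ujL) => // i /andP[ni im].
by rewrite xs ?ni ?(leq_trans im)// py// /p ltnNge ni.
Qed.

(* [z] concatenates the patterns supplied by [block_avoiding]. *)
Lemma pattern_blocks (F : nat -> set cantor_space) :
  (forall j, nowhere_dense (F j)) ->
  exists (blk : nat -> nat) (z : cantor_space),
    [/\ forall n, (blk n <= blk n.+1 <= (blk n).+1)%N,
        forall k, exists n, blk n = k
      & forall x : cantor_space,
          (forall k, exists2 l, (k <= l)%N & forall i, blk i = l -> x i = z i) ->
          ~ (\bigcup_n F n) x].
Proof.
move=> ndF.
have /choice[g gP] : forall kn : nat * nat, exists ms : nat * cantor_space,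
    (kn.2 < ms.1)%N /\ forall x : cantor_space,
      (forall i, (kn.2 <= i < ms.1)%N -> x i = ms.2 i) ->
      forall j, (j <= kn.1)%N -> ~ F j x.
  move=> [k n]; have [m [s [nm avoid]]] := block_avoiding k n ndF.
  by exists (m, s).
pose start := fix start k := if k is k'.+1 then (g (k', start k')).1 else 0%N.
have startS k : (start k < start k.+1)%N by have [] := gP (k, start k).
have startM : {mono start : i j / (i <= j)%N}.
  by apply: leq_mono; apply: homo_ltn => //; exact: ltn_trans.
pose blk := fix blk n := if n is n'.+1 then
  if n == start (blk n').+1 then (blk n').+1 else blk n' else 0%N.
have blkS n : blk n.+1 =
  if n.+1 == start (blk n).+1 then (blk n).+1 else blk n by [].
have blkP n : (start (blk n) <= n < start (blk n).+1)%N.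
  elim: n => [|n /andP[IHl IHr]]; first by have := startS 0%N.
  rewrite blkS; case: eqP => [->|nE]; first by rewrite leqnn startS.
  by rewrite (leq_trans IHl)//= ltn_neqAle IHr andbT; apply/eqP.
have blkE n k : (start k <= n < start k.+1)%N -> blk n = k.
  move=> /andP[kn nk]; have /andP[bn nb] := blkP n.
  have := leq_ltn_trans kn nb; have := leq_ltn_trans bn nk.
  by rewrite !(leqW_mono startM); lia.
exists blk, (fun i => (g (blk i, start (blk i))).2 i); split.
- by move=> n; rewrite blkS; case: ifP => _; lia.
- by move=> k; exists (start k); apply: blkE; rewrite leqnn startS.
(* The pattern of block [l] avoids every [F j] with [j <= l], so one late matching block
   suffices. *)
- move=> x xz [j _ Fjx]; have [l jl xl] := xz j.
  have [_ avoid] := gP (l, start l); apply: (avoid x _ j jl Fjx) => i /= il.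
  by have il' := blkE _ _ il; rewrite xl// il'.
Qed.

Lemma ideal_baire_blocks (I : set (set nat)) :
  is_ideal I -> ideal_baire_property I ->
  exists blk : nat -> nat,
    [/\ forall n, (blk n <= blk n.+1 <= (blk n).+1)%N,
        forall k, exists n, blk n = k
      & forall A : set nat,
          (forall k, exists2 l, (k <= l)%N & forall i, blk i = l -> A i) ->
          ~ I A].
Proof.
move=> idI [U oU [F ndF UF]].
have [blk [z [blkS blk_surj avoid]]] := pattern_blocks ndF.
exists blk; split=> // A Ablk IA.
have [[x0 Ux0]|U0] := pselect (exists x, U x); last first.
  (* Here the ideal itself is meager, and [B] follows [z] on every block inside [A]. *)
  pose B := [set i | A i /\ z i].
  have IB : I B by apply: (ideal_sub idI) IA => i [].
  apply: (avoid (char_fun B)).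
    move=> k; have [l kl lA] := Ablk k; exists l => // i /lA Ai.
    by apply/idP/idP => [/set_mem[]//|zi]; apply/mem_set.
  rewrite -UF; left; split; first by exists B.
  by move=> UB; apply: U0; exists (char_fun B).
have [m mU] := nbhs_cylinder (open_nbhs_nbhs (conj oU Ux0)).
have blk_mono : {homo blk : i j / (i <= j)%N}.
  by apply: homo_leq => //; [exact: leq_trans|move=> i; case/andP: (blkS i)].
pose x b : cantor_space :=
  fun i => if (i < m)%N then x0 i else if odd (blk i) == b then z i else true.
(* Following [z] on the blocks of one parity already forces membership, while
   the blocks of the other parity are filled: the two sets cover [m, oo[. *)
have Ix b : I [set i | x b i].
  have Ux : U (x b) by apply: mU => i im; rewrite /x im.
  have nFx : ~ (\bigcup_n F n) (x b).
    (* This index has parity [b] and exceeds both [k] and [blk m], so its block lies beyond [m]. *)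
    apply: avoid => k; exists (((k + blk m).+1).*2 + b)%N; first by lia.
    move=> i il; rewrite /x ifF; last first.
      by apply/negbTE; rewrite -leqNgt leqNgt; apply/negP => /ltnW/blk_mono; lia.
    by rewrite il oddD odd_double; case: (b); rewrite eqxx.
  have [B IB BE] : (char_fun @` I) (x b).
    by apply: contrapT => nIx; apply: nFx; rewrite -UF; right.
  by apply: (ideal_sub idI) IB => i /=; rewrite -BE => /set_mem.
apply: (ideal_proper idI).
apply: (ideal_sub idI) (idealU idI (idealU idI (Ix true) (Ix false))
                          (ideal_finite idI (finite_II m))) => i _ /=.
rewrite /x; case: ifP => im; first by right.
by left; case: (odd _); [right|left].
Qed.

(** * The density given by an ideal and an oscillating function *)

Section OscillatingDensity.

Variables (R : realType) (I : set (set nat)) (f : nat -> R).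
Hypotheses (idealI : is_ideal I) (shiftI : ideal_shift_invariant I).
Hypothesis f_slow : forall e : R, 0 < e ->
  exists N, forall n, (N <= n)%N -> `|f n.+1 - f n| <= e.
Hypothesis f_positive : forall r e : R, 0 < r <= 1 -> 0 < e ->
  ~ I [set n | r - e < f n <= r].

(* The threshold 1 is always admitted, so that unbounded sets have density 1. *)
Definition levels (A : set nat) : set R :=
  [set t | 0 < t <= 1 /\
    (t < 1 -> exists2 s, 0 < s & I (A `&` [set n | ~~ (s <= f n <= t)]))].

Definition density (A : set nat) : R := inf (levels A).

Lemma levels1 A : levels A 1.
Proof. by split; [rewrite ltr01 lexx|rewrite ltxx]. Qed.

Lemma density_le A t : levels A t -> density A <= t.
Proof. by apply: ge_inf; exists 0 => x [/andP[/ltW]]. Qed.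

Lemma le_density A x : (forall t, levels A t -> x <= t) -> x <= density A.
Proof. by apply: lb_le_inf; exists 1; exact: levels1. Qed.

Lemma density_lt A x : density A < x -> exists2 t, levels A t & t < x.
Proof. by apply: inf_lt; exists 1; exact: levels1. Qed.

(** The slack [e] absorbs the change of [f] under a translation. *)
Lemma density_le_of A B :
  (forall e t, 0 < e -> levels B t -> exists2 u, levels A u & u <= t + e) ->
  density A <= density B.
Proof.
move=> AB; apply: le_density => t Bt; apply/ler_addgt0Pr => e e0.
by have [u Au] := AB _ _ e0 Bt; apply: le_trans; exact: density_le.
Qed.

Lemma density_itv A : 0 <= density A <= 1.
Proof.
apply/andP; split; last exact/density_le/levels1.
by apply: le_density => t [/andP[/ltW]].
Qed.

Lemma density_mono A B : A `<=` B -> density A <= density B.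
Proof.
move=> AB; apply: le_density => t [t01 Bt]; apply: density_le; split=> // t1.
have [s s0 IB] := Bt t1; exists s => //.
by apply: (ideal_sub idealI) IB; exact: setSI.
Qed.

(** Hence the density of a union is bounded by the maximum, which is stronger than subadditivity. *)
Lemma levels_max A B t u :
  levels A t -> levels B u -> levels (A `|` B) (Num.max t u).
Proof.
move=> [/andP[t0 t1] At] [/andP[u0 u1] Bu]; split.
  by rewrite lt_max t0 ge_max t1.
rewrite gt_max => /andP[/At[s s0 IA] /Bu[s' s'0 IB]].
exists (Num.min s s'); first by rewrite lt_min s0.
apply: (ideal_sub idealI) (idealU idealI IA IB) => n [ABn /= nf].
case: ABn => [An|Bn]; [left|right]; split=> //=; apply: contra nf.
  by rewrite ge_min le_max => /andP[-> ->].
by rewrite ge_min le_max => /andP[-> ->]; rewrite !orbT.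
Qed.

Lemma density_subadd A B : density (A `|` B) <= density A + density B.
Proof.
apply/ler_addgt0Pr => e e0.
have [|t At te] := @density_lt A (density A + e / 2); first by lra.
have [|u Bu ue] := @density_lt B (density B + e / 2); first by lra.
apply: le_trans (density_le (levels_max At Bu)) _.
have [/andP[t0 _] _] := At; have [/andP[u0 _] _] := Bu.
by rewrite ge_max; apply/andP; split; lra.
Qed.

Lemma null_density A : density A = 0 <-> I A.
Proof.
split=> [A0|IA]; last first.
  apply/le_anti; have /andP[-> _] := density_itv A; rewrite andbT.
  apply/ler_addgt0Pr => e e0; rewrite add0r.
  apply: le_trans (_ : Num.min e 1 <= _); last by rewrite ge_min lexx.
  apply: density_le; split; first by rewrite lt_min e0 ltr01 ge_min lexx orbT.
  by move=> _; exists 1 => //; apply: (ideal_sub idealI) IA => n [].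
have [|t [/andP[t0 _] At] t1] := @density_lt A 1; first by rewrite A0.
have [s s0 IAst] := At t1.
(* The bound 1 activates the condition in [levels]; the bound [s] makes [f < s] and [f > u] cover
   everything. *)
have [|u [/andP[u0 _] Au]] := @density_lt A (Num.min s 1).
  by rewrite A0 lt_min s0 ltr01.
rewrite lt_min => /andP[us /Au[s' s'0 IAu]].
apply: (ideal_sub idealI) (idealU idealI IAst IAu) => n An.
have [sn|ns] := leP s (f n); [right|left]; split=> //=.
  by rewrite negb_and -!ltNge (lt_le_trans us sn) orbT.
by rewrite negb_and -ltNge ns.
Qed.

Lemma densityT : density setT = 1.
Proof.
apply/le_anti; have /andP[_ ->] := density_itv setT => /=.
apply: le_density => t [/andP[t0 _] At]; rewrite leNgt; apply/negP => t1.
have [s s0 It] := At t1.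
apply: (@f_positive 1 (1 - t)); [by rewrite ltr01 lexx|by rewrite subr_gt0|].
apply: (ideal_sub idealI) It => n /= /andP[tn _]; split=> //=.
by rewrite negb_and -!ltNge orbC; apply/orP; left; lra.
Qed.

Lemma density_rich : rich density.
Proof.
move=> r /andP[]; rewrite le_eqVlt => /predU1P[<- _|r0 r1].
  by exists set0; apply/null_density; exact: (ideal_finite idealI).
exists [set n | r / 2 < f n <= r]; apply/le_anti/andP; split.
  apply: density_le; split=> [|_]; first by rewrite r0.
  exists (r / 2); first by rewrite divr_gt0.
  rewrite (_ : _ `&` _ = set0); first exact: (ideal_finite idealI).
  by rewrite -subset0 => n [/= /andP[/ltW -> ->]].
apply: le_density => t [/andP[t0 _] At]; rewrite leNgt; apply/negP => tr.
have [s s0 It] := At (lt_le_trans tr r1).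
(* The bound [r / 2] keeps the points in the chosen set, and [r - t] puts [f] above [t]. *)
apply: (@f_positive r (Num.min (r / 2) (r - t))); first by rewrite r0.
  by rewrite lt_min divr_gt0//= subr_gt0.
apply: (ideal_sub idealI) It => n /= /andP[+ nr].
rewrite ltrBlDr -ltrBlDl lt_min => /andP[n1 n2]; split=> /=.
  by rewrite nr andbT; lra.
by rewrite negb_and -!ltNge orbC; apply/orP; left; lra.
Qed.

Lemma f_slowD (k : nat) (e : R) : 0 < e ->
  exists N, forall n, (N <= n)%N -> `|f (n + k)%N - f n| <= e.
Proof.
elim: k e => [|k IHk] e e0.
  by exists 0%N => n _; rewrite addn0 subrr normr0 ltW.
have [|N NP] := IHk (e / 2); first by rewrite divr_gt0.
have [|M MP] := @f_slow (e / 2); first by rewrite divr_gt0.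
exists (maxn N M) => n nNM.
have /NP nk : (N <= n)%N by lia.
have /MP nkS : (M <= n + k)%N by lia.
by rewrite addnS; move: nk nkS; rewrite !ler_norml; lra.
Qed.

Lemma f_shift (k : int) (e : R) : 0 < e ->
  exists N, forall a n : nat, (N <= a)%N -> n%:Z = a%:Z + k ->
    `|f n - f a| <= e.
Proof.
(* Both [a] and [n] lie beyond [N], so for negative [k] they can exchange roles. *)
move=> e0; have [N NP] := @f_slowD `|k|%N _ e0; exists (N + `|k|)%N => a n Na nE.
have [k0|k0] := leP 0 k.
  by rewrite (_ : n = a + `|k|)%N; [apply: NP|]; lia.
by rewrite distrC (_ : a = n + `|k|)%N; [apply: NP|]; lia.
Qed.

Lemma density_shift_le A k : density (shift A k) <= density A.
Proof.
apply: density_le_of => e t e0 [/andP[t0 t1] At].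
have [te1|te1] := leP 1 (t + e); first by exists 1 => //; exact: levels1.
exists (t + e) => //; split; first by apply/andP; split; lra.
have [|s s0 IA] := At; first by lra.
(* Beyond a finite set, the translation takes the band from [s] to [t] into the band from [s / 2] to
   [t + e]. *)
have [|N NP] := @f_shift k (Num.min (s / 2) e).
  by rewrite lt_min e0 divr_gt0.
move=> _; exists (s / 2); first by rewrite divr_gt0.
have IN : I (shift `I_N k).
  by apply: shiftI; apply: (ideal_finite idealI); exact: finite_II.
apply: (ideal_sub idealI) (idealU idealI (shiftI k IA) IN).
move=> n [[a Aa nE] /= nf].
have [Na|aN] := leqP N a; [left|right]; exists a => //; split=> //=.
apply: contra nf => /andP[sa ta]; have := NP a n Na nE.
by rewrite le_min => /andP[]; rewrite !ler_norml => ? ?; apply/andP; split; lra.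
Qed.

Lemma density_shift : density_shift_invariant density.
Proof.
move=> A k; apply/le_anti; rewrite density_shift_le /=.
(* Translating back recovers [A] except for points below [|k|] that a negative [k] pushes out of
   N. *)
have AE : A `<=` shift (shift A k) (- k) `|` `I_`|k|%N.
  move=> a Aa; have [ak|ka] := ltnP a `|k|%N; [by right|left].
  exists `|(a%:Z + k)%R|%N; last by lia.
  by exists a => //; lia.
have /null_density k0 : I `I_`|k|%N.
  by apply: (ideal_finite idealI); exact: finite_II.
apply: le_trans (density_mono AE) _; apply: le_trans (density_subadd _ _) _.
by rewrite k0 addr0 density_shift_le.
Qed.

Lemma density_is_upper_density : is_upper_density density.
Proof.
split; [exact: density_itv|exact: densityT| |exact: density_mono|
  exact: density_subadd].
by move=> F finF; apply/null_density; exact: (ideal_finite idealI).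
Qed.

Lemma null_sets_density : null_sets density = I.
Proof. by apply/funext => A; apply/propext; exact: null_density. Qed.

End OscillatingDensity.

(** * A slowly varying sequence that returns near every value *)

Section Wave.

Variable R : realType.

(* On [2 ^ m, 2 ^ m.+1] this runs linearly from 1 down to 0 and back up to 1. *)
Definition wave (k : nat) : R :=
  `|(2 * k)%:R / (2 ^ trunc_log 2 k)%:R - 3|.

Lemma exp2_small (e : R) : 0 < e -> exists M, forall m, (M <= m)%N ->
  2 / (2 ^ m)%:R < e.
Proof.
move=> e0; exists (Num.truncn (2 / e)).+1 => m Mm.
rewrite ltr_pdivrMr ?ltr0n ?expn_gt0// mulrC -ltr_pdivrMr//.
apply: lt_le_trans (truncnS_gt _) _; rewrite ler_nat (leq_trans Mm)//.
exact/ltnW/ltn_expl.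
Qed.

(** Within a dyadic block the slope is [2 / 2 ^ m] up to sign. *)
Lemma waveS k : (0 < k)%N ->
  `|wave k.+1 - wave k| <= 2 / (2 ^ trunc_log 2 k)%:R.
Proof.
move=> k0; set m := trunc_log 2 k.
have m0 : 0 < (2 ^ m)%:R :> R by rewrite ltr0n expn_gt0.
have km := trunc_log_ltn k (isT : 1 < 2)%N.
have mk := trunc_logP (isT : 1 < 2)%N k0.
(* The formulas of consecutive dyadic blocks agree at their common endpoint. *)
have -> : wave k.+1 = `|(2 * k.+1)%:R / (2 ^ m)%:R - 3|.
  have [kE|kE] := eqVneq k.+1 (2 ^ m.+1)%N; last first.
    rewrite /wave (_ : trunc_log 2 k.+1 = m)//; apply: trunc_log_eq => //.
    by rewrite (leq_trans mk)//= ltn_neqAle kE.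
  rewrite /wave kE trunc_expnK// natrM mulfK ?pnatr_eq0 ?expn_eq0//.
  rewrite expnS natrM mulrA mulfK ?gt_eqF//.
  by rewrite -normrN; congr (`|_|); ring.
apply: le_trans (ler_dist_dist _ _) _.
rewrite opprB addrA subrK -mulrBl -natrB; last by lia.
by rewrite (_ : 2 * k.+1 - 2 * k = 2)%N ?ger0_norm ?divr_ge0//; lia.
Qed.

Lemma wave_slow (e : R) : 0 < e ->
  exists N, forall k, (N <= k)%N -> `|wave k.+1 - wave k| <= e.
Proof.
move=> /exp2_small[M MP]; exists (2 ^ M)%N => k Mk.
have k0 : (0 < k)%N by rewrite (leq_trans _ Mk)// expn_gt0.
by apply: le_trans (waveS k0) _; apply/ltW/MP; exact: trunc_log_max.
Qed.

Lemma wave_recurrent (r e : R) K : 0 < r <= 1 -> 0 < e ->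
  exists2 k, (K <= k)%N & r - e < wave k <= r.
Proof.
move=> /andP[r0 r1] e0.
(* A step below [r] keeps the sampled point on the descending half; a step below [e] gives the lower
   bound. *)
have [|M MP] := @exp2_small (Num.min r e); first by rewrite lt_min r0.
pose m := maxn K M; have := MP m (leq_maxr _ _); rewrite lt_min => /andP[mr me].
have m0 : 0 < (2 ^ m)%:R :> R by rewrite ltr0n expn_gt0.
(* The descending half takes the value [r] at the real offset [x]; the next integer [j.+1]
   undershoots by at most one step. *)
pose x := (1 - r) * (2 ^ m)%:R / 2.
have /truncn_itv/andP[] : 0 <= x.
  by rewrite divr_ge0// mulr_ge0 ?subr_ge0// ltW.
set j := Num.truncn x => jx xj.
pose y : R := j.+1%:R * (2 / (2 ^ m)%:R).
have xE : x * (2 / (2 ^ m)%:R) = 1 - r by rewrite /x; field; rewrite gt_eqF.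
have q0 : 0 < 2 / (2 ^ m)%:R :> R by rewrite divr_gt0.
have y1 : 1 - r < y by rewrite -xE /y ltr_pM2r.
have y2 : y <= 1 - r + 2 / (2 ^ m)%:R.
  by rewrite -xE /y -natr1 mulrDl mul1r lerD2r ler_pM2r.
have jm : (j.+1 < 2 ^ m)%N.
  rewrite -(ltr_nat R) -(ltr_pM2r q0) -/y mulrCA divff ?gt_eqF// mulr1; lra.
exists (2 ^ m + j.+1)%N.
  have /ltnW m2 := ltn_expl m (isT : 1 < 2)%N.
  exact: leq_trans (leq_maxl K M) (leq_trans m2 (leq_addr _ _)).
have -> : wave (2 ^ m + j.+1) = 1 - y.
  rewrite /wave (@trunc_log_eq _ m)//; last first.
    by rewrite leq_addr expnS mul2n -addnn ltn_add2l.
  rewrite natrM natrD (_ : _ - 3 = y - 1); last first.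
    by rewrite /y; field; rewrite gt_eqF.
  by rewrite ler0_norm ?opprB//; lra.
by apply/andP; split; lra.
Qed.

End Wave.

Theorem theorem3p3 (R : realType) (I : set (set nat))
    (idealI : is_ideal I) (shiftI : ideal_shift_invariant I)
    (baireI : ideal_baire_property I) :
  exists delta : set nat -> R,
    [/\ is_upper_density delta, density_shift_invariant delta, rich delta
      & null_sets delta = I].
Proof.
have [blk [blkS blk_surj blkI]] := ideal_baire_blocks idealI baireI.
pose f n : R := wave R (blk n).
have f_slow e : 0 < e -> exists N, forall n, (N <= n)%N -> `|f n.+1 - f n| <= e.
  move=> e0; have [K KP] := wave_slow e0; have [N NK] := blk_surj K.
  have blk_mono : {homo blk : i j / (i <= j)%N}.
    by apply: homo_leq => //; [exact: leq_trans|move=> i; case/andP: (blkS i)].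
  (* Since [blk] grows by at most 1, an increment of [f] is zero or a single increment of [wave]. *)
  exists N => n /blk_mono; rewrite NK => /KP; rewrite /f.
  have /andP[] := blkS n; rewrite leq_eqVlt => /predU1P[<- _ _|lt le].
    by rewrite subrr normr0 ltW.
  by rewrite (_ : blk n.+1 = (blk n).+1)//; apply/eqP; rewrite eqn_leq lt le.
(* Whole blocks of arbitrarily large index lie in this set. *)
have f_positive r e : 0 < r <= 1 -> 0 < e -> ~ I [set n | r - e < f n <= r].
  move=> r01 e0; apply: blkI => k.
  have [l kl lr] := wave_recurrent k r01 e0.
  by exists l => // i /= il; rewrite /f il.
exists (density I f); split.
- exact: density_is_upper_density.
- exact: density_shift.
- exact: density_rich.
- exact: null_sets_density.
Qed.
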